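(* Let $S$ be a numerical semigroup. Every linear surjective endopattern $p$ of $S$ is homogeneous. Moreover, if $p$ is a premonic homogeneous linear endopattern of $S$, then $p$ is surjective, i.e. $p(S)=S$.
   Context: $\mathbb{Z}_+$ denotes the set of non-negative integers. A numerical semigroup is a subset of $\mathbb{Z}_+$ that contains $0$, is closed under addition and has finite complement in $\mathbb{Z}_+$. A linear endopattern of $S$ is a polynomial $p(X_1,\dots,X_n)=\sum_{i=1}^n a_iX_i+a_0$ with integer coefficients such that $p(s_1,\dots,s_n)\in S$ for every non-increasing sequence $s_1\ge\cdots\ge s_n$ of elements of $S$. Its image is $p(S)=\{p(s_1,\dots,s_n): s_1\ge\cdots\ge s_n,\ s_i\in S\}$, and it is a surjective endopattern of $S$ if $p(S)=S$. It is homogeneous if $a_0=0$, and premonic if $\sum_{i=1}^{n'}a_i=1$ for some $1\le n'\leq n$. *)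

(* Defs.v *)
From mathcomp Require Import all_boot all_order all_algebra.
From mathcomp Require Import mpoly.
From mathcomp Require Import boolp classical_sets functions cardinality.

Set Implicit Arguments.
Unset Strict Implicit.
Unset Printing Implicit Defensive.

Import GRing.Theory.
Local Open Scope classical_set_scope.
Local Open Scope ring_scope.

Definition numerical_semigroup (S : set nat) : Prop :=
  [/\ S 0%N,
      forall x y : nat, S x -> S y -> S (x + y)%N
    & finite_set (~` S)].

(* Patterns have integer coefficients and so take values in int; S is compared
   with those values through its copy inside int. *)
Definition int_image (S : set nat) : set int := [set Posz m | m in S].

(* The index i : 'I_n, which starts at 0, stands for the variable X_(i+1). *)
Definition nonincreasing_seqs (n : nat) (S : set nat) : set ('I_n -> nat) :=
  [set s | (forall i, S (s i)) /\
           (forall i j : 'I_n, (i <= j)%N -> (s j <= s i)%N)].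

Definition pattern_eval (n : nat) (p : {mpoly int[n]}) (s : 'I_n -> nat) : int :=
  p.@[fun i => Posz (s i)].

Definition linear_pattern (n : nat) (p : {mpoly int[n]}) : Prop :=
  exists (a : 'I_n -> int) (a0 : int),
    p = \sum_(i < n) a i *: 'X_i + a0%:MP_[n].

Definition linear_endopattern (S : set nat) (n : nat) (p : {mpoly int[n]}) : Prop :=
  linear_pattern p /\
  (forall s, nonincreasing_seqs S s -> int_image S (pattern_eval p s)).

Definition pattern_image (S : set nat) (n : nat) (p : {mpoly int[n]}) : set int :=
  [set pattern_eval p s | s in @nonincreasing_seqs n S].

Definition surjective_endopattern (S : set nat) (n : nat) (p : {mpoly int[n]}) : Prop :=
  linear_endopattern S p /\ pattern_image S p = int_image S.

(* Only the constant term a_0 is required to vanish, so the zero polynomial is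
   homogeneous; this is meant for linear patterns. *)
Definition homogeneous_pattern (n : nat) (p : {mpoly int[n]}) : Prop :=
  p@_0%MM = 0.

(* p@_U_(i) is the coefficient a_(i+1), so the sum is a_1 + ... + a_n'. *)
Definition premonic_pattern (n : nat) (p : {mpoly int[n]}) : Prop :=
  exists n' : nat, (1 <= n' <= n)%N /\ \sum_(i < n | (i < n')%N) p@_U_(i)%MM = 1.

(* Main.v *)
Require Import Defs.
From mathcomp Require Import all_boot all_order all_algebra.
From mathcomp Require Import mpoly.
From mathcomp Require Import boolp classical_sets functions cardinality.

(** Both halves rest on two closure properties of the non-increasing sequences
    of elements of [S]: a sequence may be doubled, and a constant sequence may
    be cut off, that is, continued by zeros.

    Write [p = L + a_0] with [L] linear.  The zero sequence gives [a_0 = p(0)],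
    an element of [S], so [a_0 >= 0].  If [p] is surjective, then [0] is a value
    of [p], so some [s] satisfies [L(s) = - a_0].  Doubling it,
    [p(2 s) = 2 L(s) + a_0 = - a_0] lies in [S] as well, so [- a_0 >= 0] and
    [a_0 = 0].

    If [p = L] is premonic with [a_1 + ... + a_n' = 1], then every [m] in [S] is
    the value of [p] at the sequence with [n'] terms [m] followed by zeros. *)

Import Order.Theory GRing.Theory Num.Theory.
Local Open Scope ring_scope.

(** Expressing the coefficients through [p] itself, and not through the witnesses
    of linearity, matches the way homogeneity and premonicity are stated. *)
Lemma linear_pattern_evalE {n : nat} (p : {mpoly int[n]}) (s : 'I_n -> nat) :
  linear_pattern p ->
  pattern_eval p s = \sum_(i < n) p@_U_(i) * Posz (s i) + p@_0.
Proof.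
move=> [a [a0 ->]].
rewrite /pattern_eval mevalD mevalC raddf_sum /=.
congr (_ + _).
- apply: eq_bigr => i _; rewrite mevalZ mevalXU; congr (_ * _).
  rewrite mcoeffD mcoeffC raddf_sum /= (bigD1 i) //= mcoeffZ mcoeffXU eqxx mulr1.
  rewrite big1 => [|j neq_ji]; last first.
    by rewrite mcoeffZ mcoeffXU (negbTE neq_ji) mulr0.
  by rewrite mnm1_eq0 mulr0 !addr0.
- rewrite mcoeffD mcoeffC eqxx mulr1 raddf_sum /= big1 ?add0r // => i _.
  by rewrite mcoeffZ mcoeffX mnm1_eq0 mulr0.
Qed.

Lemma int_image_ge0 {S : set nat} {x : int} : int_image S x -> 0 <= x.
Proof. by case=> m _ <-. Qed.

Lemma nonincreasing_seqs_cutoff {S : set nat} (n k : nat) {m : nat} :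
  S 0%N -> S m ->
  nonincreasing_seqs S (fun i : 'I_n => if (i < k)%N then m else 0%N).
Proof.
move=> S0 Sm; split=> [i | i j le_ij]; first by case: ifP.
by case: ltnP => // lt_jk; rewrite (leq_ltn_trans le_ij lt_jk).
Qed.

Lemma nonincreasing_seqs_double {S : set nat} {n : nat} {s : 'I_n -> nat} :
  (forall x y : nat, S x -> S y -> S (x + y)%N) ->
  nonincreasing_seqs S s -> nonincreasing_seqs S (fun i => s i + s i)%N.
Proof.
move=> SD [Ss s_mono]; split=> [i | i j le_ij]; first exact: SD.
by apply: leq_add; apply: s_mono.
Qed.

Lemma surjective_endopattern_homogeneous
    (S : set nat) (n : nat) (p : {mpoly int[n]}) :
  S 0%N -> (forall x y : nat, S x -> S y -> S (x + y)%N) ->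
  surjective_endopattern S p -> homogeneous_pattern p.
Proof.
move=> S0 SD [[p_lin p_endo] p_surj].
have a0_ge0 : 0 <= p@_0.
  have := int_image_ge0 (p_endo _ (nonincreasing_seqs_cutoff n 0%N S0 S0)).
  by rewrite linear_pattern_evalE // big1 ?add0r // => i _; rewrite mulr0.
have [s s_mono ps0] : pattern_image S p 0 by rewrite p_surj; exists 0%N.
have := int_image_ge0 (p_endo _ (nonincreasing_seqs_double SD s_mono)).
move: ps0; rewrite !linear_pattern_evalE // => ps0.
under eq_bigr do rewrite PoszD mulrDr.
(* The doubled sequence takes the value [L(s) + (L(s) + a_0) = L(s) = - a_0]. *)
move: ps0 => /eqP; rewrite addr_eq0 => /eqP Ls.
rewrite big_split /= -addrA Ls addNr addr0 oppr_ge0 => a0_le0.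
by apply/eqP; rewrite eq_le a0_le0.
Qed.

Lemma premonic_endopattern_surjective
    (S : set nat) (n : nat) (p : {mpoly int[n]}) :
  S 0%N -> linear_endopattern S p -> homogeneous_pattern p ->
  premonic_pattern p -> pattern_image S p = int_image S.
Proof.
move=> S0 [p_lin p_endo] p_hom [n' [_ sum_a]].
rewrite eqEsubset; split=> [_ [s s_mono <-] | _ [m Sm <-]]; first exact: p_endo.
exists (fun i : 'I_n => if (i < n')%N then m else 0%N).
  exact: nonincreasing_seqs_cutoff.
rewrite linear_pattern_evalE // p_hom addr0 -[RHS]mul1r -sum_a mulr_suml.
by rewrite [RHS]big_mkcond; apply: eq_bigr => i _; case: ifP => // _; rewrite mulr0.
Qed.

Theorem proposition16 (S : set nat) (hS : numerical_semigroup S) :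
  (forall (n : nat) (p : {mpoly int[n]}),
     surjective_endopattern S p -> homogeneous_pattern p) /\
  (forall (n : nat) (p : {mpoly int[n]}),
     linear_endopattern S p -> homogeneous_pattern p -> premonic_pattern p ->
     pattern_image S p = int_image S).
Proof.
have [S0 SD _] := hS; split=> n p.
- exact: surjective_endopattern_homogeneous.
- exact: premonic_endopattern_surjective.
Qed.
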